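(* For each of the games T, R and TR, for every $\varepsilon>0$ and for every integer $k\ge 1$ there is a $k$-connected graph $G$ with nonnegative vertex weights for which Bob has a strategy to obtain vertices of total weight at least $(1-\varepsilon)$ times the total weight of all vertices of $G$.
   Context: Let $G$ be a connected graph with nonnegative weights on its vertices. Two players, Alice and Bob, alternately take one not-yet-taken vertex of $G$ per turn, Alice moving first. The vertices must be taken according to one or both of the following rules: (T) the subgraph of $G$ induced by the taken vertices is connected during the whole game; (R) the subgraph of $G$ induced by the remaining (not yet taken) vertices is connected during the whole game. In game T only rule (T) is required, in game R only rule (R), in game TR both (T) and (R). The game ends when no further vertex can be taken (in games T and R and in game TR on 2-connected graphs this happens only when all vertices are taken). Each player obtains the total weight of the vertices he or she took. *)

(* Defs.v *)
From HB Require Import structures.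
From mathcomp Require Import all_boot all_order all_algebra.
From mathcomp Require Import reals.

Set Implicit Arguments.
Unset Strict Implicit.
Unset Printing Implicit Defensive.

Import Order.TTheory GRing.Theory Num.Theory.
Local Open Scope ring_scope.

(* T: the taken vertices must always induce a connected subgraph;
   R: the remaining vertices must. *)
Inductive game := GameT | GameR | GameTR.

Definition requires_T (g : game) : bool :=
  match g with GameT | GameTR => true | GameR => false end.

Definition requires_R (g : game) : bool :=
  match g with GameR | GameTR => true | GameT => false end.

Definition simple_graph (V : finType) (e : rel V) : Prop :=
  symmetric e /\ irreflexive e.

Definition induced (V : finType) (e : rel V) (S : {set V}) : rel V :=
  [rel x y | [&& x \in S, y \in S & e x y]].

(* The empty subgraph counts as connected, so that when the remaining vertices
   must induce a connected subgraph the last vertex can still be taken. *)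
Definition connected_on (V : finType) (e : rel V) (S : {set V}) : bool :=
  [forall x in S, forall y in S, connect (induced e S) x y].

Definition k_connected (V : finType) (e : rel V) (k : nat) : Prop :=
  (k < #|V|)%N /\
  forall X : {set V}, (#|X| < k)%N -> connected_on e (~: X).

(* A history is the sequence of taken vertices, earliest first. As Alice moves
   first, the vertices at even positions (from 0) are hers, those at odd
   positions are Bob's, and Bob is to move when the history has odd length. *)
Definition legal_move (g : game) (V : finType) (e : rel V)
    (h : seq V) (x : V) : bool :=
  [&& x \notin h,
      requires_T g ==> connected_on e [set y in rcons h x] &
      requires_R g ==> connected_on e (~: [set y in rcons h x])].

Definition game_over (g : game) (V : finType) (e : rel V) (h : seq V) : Prop :=
  forall x, ~~ legal_move g e h x.

Inductive play_against (g : game) (V : finType) (e : rel V)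
    (sigma : seq V -> V) : seq V -> Prop :=
| play_start : play_against g e sigma [::]
| play_alice (h : seq V) (x : V) :
    play_against g e sigma h -> ~~ odd (size h) -> legal_move g e h x ->
    play_against g e sigma (rcons h x)
| play_bob (h : seq V) :
    play_against g e sigma h -> odd (size h) -> legal_move g e h (sigma h) ->
    play_against g e sigma (rcons h (sigma h)).

(* Bob may not pass or get stuck: sigma must answer with a legal move whenever
   there is one. *)
Definition bob_strategy (g : game) (V : finType) (e : rel V)
    (sigma : seq V -> V) : Prop :=
  forall h : seq V, play_against g e sigma h -> odd (size h) ->
    ~ game_over g e h -> legal_move g e h (sigma h).

Definition bob_gain (R : realType) (V : finType) (w : V -> R)
    (h : seq V) : R :=
  \sum_(i < size h | odd i) w (tnth (in_tuple h) i).

Definition bob_can_obtain (g : game) (R : realType) (V : finType) (e : rel V)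
    (w : V -> R) (c : R) : Prop :=
  exists sigma : seq V -> V,
    bob_strategy g e sigma /\
    forall h : seq V, play_against g e sigma h -> game_over g e h ->
      c <= bob_gain w h.

(* Main.v *)
(* Game T: weighted vertices of weight 1 hang off a large clique of weightless
   vertices, each with its own odd set of clique neighbours. Whenever Alice
   first touches such a column she opens its weighted vertex and Bob takes it;
   all other moves he answers in the same column, so after her first move Alice
   gets nothing.

   Games R and TR: let t = 2^j be large. Coins x_l (of weight 1) form a clique,
   and for every set S of at least two indices with |S| = 1 mod t there is a
   weightless lock adjacent to the x_l with l in S; one or two weightless hubs
   are adjacent to everything. Bob first takes the hubs, which makes rule (T)
   vacuous, and then coins until t of them are gone. Let T be the set of taken
   coins. From then on x_l can only be taken when no remaining lock S has
   S \ T = {l}. Group the remaining vertices by S \ T (a coin counting as the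
   lock of a singleton). Had no lock been taken, all groups would be even, so at
   the start of this phase few groups are odd. Bob always moves in an odd group,
   which exists by parity of the total. Alice can take a coin only when it is
   alone in its group, hence odd, so each coin she takes destroys an odd group,
   and Bob never lets their number grow over a round. *)

Require Import Defs.
From HB Require Import structures.
From mathcomp Require Import all_boot all_order all_algebra.
From mathcomp Require Import reals.
From mathcomp Require Import zify.

Set Implicit Arguments.
Unset Strict Implicit.
Unset Printing Implicit Defensive.

Import Order.TTheory GRing.Theory Num.Theory.
Local Open Scope ring_scope.

(** * Counting what each player has taken *)

Lemma big_tnth_rcons (A : nmodType) (V : Type) (Q : pred nat) (F : V -> A)
    (h : seq V) (x : V) :
  \sum_(i < size (rcons h x) | Q i) F (tnth (in_tuple (rcons h x)) i) =
  \sum_(i < size h | Q i) F (tnth (in_tuple h) i) +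
  (if Q (size h) then F x else 0).
Proof.
have E s : \sum_(i < size s | Q i) F (tnth (in_tuple s) i) =
    \sum_(0 <= i < size s | Q i) F (nth x s i).
  by rewrite big_mkord; apply: eq_bigr => i _; rewrite (tnth_nth x).
rewrite !E size_rcons big_mkcond big_nat_recr //= -big_mkcond /=.
rewrite nth_rcons ltnn eqxx; congr (_ + _).
by apply: congr_big_nat => // i /andP[_ /andP[_ lt_i]]; rewrite nth_rcons lt_i.
Qed.

Definition alice_count (V : Type) (P : pred V) (h : seq V) : nat :=
  (\sum_(i < size h | ~~ odd i) P (tnth (in_tuple h) i))%N.

Lemma alice_count_nil (V : Type) (P : pred V) : alice_count P [::] = 0%N.
Proof. by rewrite /alice_count big_ord0. Qed.

Lemma alice_count_rcons (V : Type) (P : pred V) (h : seq V) (x : V) :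
  alice_count P (rcons h x) = (alice_count P h + (~~ odd (size h) && P x))%N.
Proof.
rewrite /alice_count (@big_tnth_rcons nat _ (fun i => ~~ odd i) (fun v => P v : nat)).
by case: (odd _).
Qed.

Lemma alice_count_size (V : Type) (P : pred V) (h : seq V) :
  (2 * alice_count P h <= size h + odd (size h))%N.
Proof.
elim/last_ind: h => [|h x IH]; first by rewrite alice_count_nil.
by rewrite alice_count_rcons size_rcons /=; case: odd IH; case: (P x) => /=; lia.
Qed.

(** Turns a lower bound on Bob's gain into an upper bound, among natural numbers, on how many
    vertices of [P] Alice takes. *)
Lemma bob_gain_alice_count (R : realType) (V : finType) (P : pred V) (h : seq V) :
  bob_gain (fun v => (P v)%:R : R) h + (alice_count P h)%:R = (count P h)%:R.
Proof.
elim/last_ind: h => [|h x IH].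
  by rewrite alice_count_nil /bob_gain big_ord0 addr0.
rewrite alice_count_rcons /bob_gain.
rewrite (@big_tnth_rcons _ _ (fun i => odd i) (fun v => (P v)%:R : R)).
rewrite -/(bob_gain _ _) -cats1 count_cat /= addn0 !natrD -IH.
by case: (odd _) => /=; rewrite ?addr0 ?addrA // addrAC.
Qed.

Lemma set_rcons (V : finType) (h : seq V) (x : V) :
  [set y in rcons h x] = x |: [set y in h].
Proof. by apply/setP => y; rewrite !inE mem_rcons inE. Qed.

(** * Connectivity of induced subgraphs *)

Section Connectivity.
Variables (V : finType) (e : rel V).

Lemma connected_on_nbr (A : {set V}) (v w : V) :
  connected_on e A -> v \in A -> w \in A -> v != w ->
  exists2 u, u \in A & e v u.
Proof.
move=> cA vA wA vw.
have /connectP[[|u p] /= pth E] := forall_inP (forall_inP cA v vA) w wA.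
  by rewrite E eqxx in vw.
by case/andP: pth => /and3P[_ uA vu] _; exists u.
Qed.

(** Paths go through the clique [B]: each vertex of [A] lies in [B] or is one step from a vertex of
    [A] in [B], and any two of the latter are equal or adjacent. *)
Lemma connected_on_hub (A : {set V}) (B : pred V) :
  symmetric e ->
  (forall u v, B u -> B v -> u != v -> e u v) ->
  (forall v, v \in A -> ~~ B v -> exists2 u, u \in A & B u && e v u) ->
  connected_on e A.
Proof.
move=> sym cB dom.
have symI : symmetric (induced e A).
  by move=> x y; rewrite /induced /= sym andbCA.
have hub v : v \in A -> exists2 u, (u \in A) && B u & connect (induced e A) v u.
  move=> vA; have [Bv|nBv] := boolP (B v); first by exists v; rewrite ?vA.
  have [u uA /andP[Bu vu]] := dom v vA nBv.
  by exists u; rewrite ?uA //; apply: connect1; rewrite /induced /= vA uA.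
apply/forall_inP => x xA; apply/forall_inP => y yA.
have [u /andP[uA Bu] xu] := hub x xA; have [v /andP[vA Bv] yv] := hub y yA.
apply: connect_trans xu _; rewrite (sym_connect_sym symI).
apply: connect_trans yv _; have [->|vu] := eqVneq v u; first exact: connect0.
by apply: connect1; rewrite /induced /= vA uA cB.
Qed.

Lemma connected_onU1 (A : {set V}) (x y : V) :
  symmetric e -> connected_on e A -> y \in A -> e x y ->
  connected_on e (x |: A).
Proof.
move=> sym cA yA xy.
have symI : symmetric (induced e (x |: A)).
  by move=> u v; rewrite /induced /= sym andbCA.
have toy u : u \in x |: A -> connect (induced e (x |: A)) u y.
  rewrite in_setU1 => /predU1P[->|uA].
    by apply: connect1; rewrite /induced /= !in_setU1 eqxx yA xy orbT.
  apply: connect_sub (forall_inP (forall_inP cA u uA) y yA) => a b /and3P[aA bA ab].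
  by apply: connect1; rewrite /induced /= !in_setU1 aA bA ab !orbT.
apply/forall_inP => u uA; apply/forall_inP => v vA.
by apply: connect_trans (toy u uA) _; rewrite (sym_connect_sym symI) toy.
Qed.

Lemma connected_on1 (x : V) : connected_on e [set x].
Proof.
by apply/forall_inP => u /set1P->; apply/forall_inP => v /set1P->; apply: connect0.
Qed.

End Connectivity.

(** * Strategies given by a preference among legal moves *)

Section GreedyStrategy.
Variables (g : game) (V : finType) (e : rel V) (good : seq V -> pred V) (v0 : V).

(** Falling back to any legal move makes this a valid strategy whatever [good] is; [v0] is returned
    only when the game is over. *)
Definition prefer (h : seq V) : V :=
  if [pick v | legal_move g e h v && good h v] is Some v then v
  else odflt v0 [pick v | legal_move g e h v].

Lemma prefer_strategy : bob_strategy g e prefer.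
Proof.
move=> h _ _ nover; rewrite /prefer; case: pickP => [v /andP[]//|_].
case: pickP => [v //|none]; case: nover => x.
by rewrite none.
Qed.

Lemma prefer_good (h : seq V) (v : V) :
  legal_move g e h v -> good h v ->
  legal_move g e h (prefer h) && good h (prefer h).
Proof.
move=> lv gv; rewrite /prefer; case: pickP => [//|none].
by have := none v; rewrite lv gv.
Qed.

End GreedyStrategy.

Lemma play_uniq (g : game) (V : finType) (e : rel V) sigma (h : seq V) :
  play_against g e sigma h -> uniq h.
Proof.
by elim=> // {}h => [x|] _ uh _ /and3P[xh _ _]; rewrite rcons_uniq xh.
Qed.

Lemma bob_can_obtain_of_count (g : game) (R : realType) (V : finType)
    (e : rel V) (P : pred V) (eps : R) (c : nat) sigma :
  bob_strategy g e sigma ->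
  (forall h, play_against g e sigma h -> game_over g e h ->
    (forall v, P v -> v \in h) /\ (alice_count P h <= c)%N) ->
  c%:R <= eps * #|P|%:R ->
  bob_can_obtain g e (fun v => (P v)%:R : R)
    ((1 - eps) * \sum_(v : V) (P v)%:R).
Proof.
move=> strat final hc; exists sigma; split=> // h ph oh.
have [allP hA] := final h ph oh.
have -> : \sum_(v : V) (P v)%:R = #|P|%:R :> R.
  by rewrite -sum1_card natr_sum [RHS]big_mkcond; apply: eq_bigr => v _; case: ifP; rewrite unfold_in => ->.
have cP : count P h = #|P|.
  rewrite -size_filter -(card_uniqP (filter_uniq _ (play_uniq ph))).
  apply: eq_card => v; rewrite mem_filter; apply/andP/idP => [[]//|Pv].
  by split=> //; apply: allP.
have gainE := bob_gain_alice_count R P h; rewrite cP in gainE.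
rewrite mulrBl mul1r lerBlDr -{1}gainE lerD2l.
by apply: le_trans hc; rewrite ler_nat.
Qed.

(** * Game T *)

Section GameT.
Variables (m n : nat).
Local Notation V := ('I_m * 'I_n.+2)%type.

(* [(i, ord0)] is the weighted vertex of column [i]. *)
Definition weighted (v : V) : bool := v.2 == ord0.

Definition blob : rel V :=
  [rel u v | (u != v) && (~~ weighted u && ~~ weighted v || (u.1 == v.1))].

Lemma blob_sym : symmetric blob.
Proof. by move=> u v; rewrite /blob /= (eq_sym v) (andbC (~~ weighted v)) (eq_sym v.1). Qed.

(** The weightless vertices form a clique, and each weighted vertex has [n.+1] neighbours in it, too
    many for [X] to contain them all. *)
Lemma blob_k_connected (k : nat) :
  (0 < m)%N -> (k <= n)%N -> k_connected blob k.
Proof.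
move=> m0 kn; split.
  by rewrite card_prod !card_ord; nia.
move=> X Xk; apply: (@connected_on_hub _ _ _ (fun v => ~~ weighted v)).
- exact: blob_sym.
- by move=> u v nu nv uv; rewrite /blob /= uv nu nv.
move=> v vX /negbNE wv.
pose f (j : 'I_n.+1) : V := (v.1, lift ord0 j).
have f_inj : injective f by move=> i j /(congr1 snd)/lift_inj.
have : ~~ (f @: setT \subset X).
  apply/negP => /subset_leq_card; rewrite card_imset // cardsT card_ord; lia.
case/subsetPn => _ /imsetP[j _ ->] fX; exists (f j); first by rewrite inE.
rewrite /blob /weighted /f /= eqxx !orbT !andbT /=.
by apply: contraTneq wv => ->; rewrite /weighted.
Qed.

Lemma count_column (h : seq V) (i : 'I_m) :
  uniq h -> (forall v, v.1 = i -> v \in h) ->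
  count (fun v => v.1 == i) h = n.+2.
Proof.
move=> uh all_i; rewrite -size_filter -(card_uniqP (filter_uniq _ uh)).
rewrite -[RHS](card_ord n.+2) -(card_imset predT (f := fun j => (i, j))).
  apply: eq_card => v; rewrite mem_filter; apply/andP/imsetP.
    by case=> /eqP <- _; exists v.2 => //; case: v.
  by case=> j _ ->; rewrite eqxx all_i.
by move=> j j' [].
Qed.

Lemma legal_T (h : seq V) (x y : V) :
  x \notin h -> y \in h -> connected_on blob [set v in h] -> blob x y ->
  legal_move GameT blob h x.
Proof.
move=> xh yh ch xy; rewrite /legal_move xh andbT set_rcons /=.
by apply: connected_onU1 ch _ xy; rewrite ?inE //; apply: blob_sym.
Qed.

Lemma legal_T_nbr (h : seq V) (x y : V) :
  legal_move GameT blob h x -> y \in h -> exists2 u, u \in h & blob x u.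
Proof.
move=> /and3P[xh cx _] yh; rewrite set_rcons in cx.
have [|||u] := connected_on_nbr (v := x) (w := y) cx.
- by rewrite setU11.
- by rewrite !inE yh orbT.
- by apply: contraNneq xh => ->.
rewrite !inE => /predU1P[->|uh xu]; last by exists u.
by rewrite /blob /= eqxx.
Qed.

Lemma legal_T_nil (x : V) : legal_move GameT blob [::] x.
Proof.
by rewrite /legal_move set_rcons set_nil setU0 connected_on1.
Qed.

(** [last u s] is Alice's latest move. Bob stays in her column and takes a weightless vertex there
    only once the weighted one is gone. *)
Definition answer (h : seq V) (v : V) : bool :=
  if h is u :: s then
    (v.1 == (last u s).1) && (weighted v || (((last u s).1, ord0) \in h))
  else false.

Hypothesis even_n : ~~ odd n.
Variable v0 : V.
Local Notation sigma := (prefer GameT blob answer v0).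

(** The invariant after each reply of Bob. The bound [h != [::]], read as 0 or 1, allows Alice a
    weighted vertex on her first move only. *)
Definition balanced (h : seq V) : Prop :=
  [/\ uniq h, connected_on blob [set v in h],
      (forall i, ~~ odd (count (fun v => v.1 == i) h)),
      (forall v, v \in h -> (v.1, ord0) \in h) &
      (alice_count weighted h <= (h != [::]))%N].

(** A column has the even number [n.+2] of vertices, and Alice's move leaves an odd number of them
    taken, so a vertex of it remains for Bob. If the weighted one is free, it is adjacent to [x]. *)
Lemma balanced_rcons (h : seq V) (x : V) :
  balanced h -> ~~ odd (size h) -> legal_move GameT blob h x ->
  exists2 v, legal_move GameT blob (rcons h x) v & answer (rcons h x) v.
Proof.
move=> [uh ch even_h wh _] even_sh lx.
have [xh cx _] := and3P lx; move: cx => /= cx.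
have ux : uniq (rcons h x) by rewrite rcons_uniq xh.
have ansE v : answer (rcons h x) v =
    (v.1 == x.1) && (weighted v || ((x.1, ord0) \in rcons h x)).
  by rewrite /answer; case: (h) => //= a s; rewrite last_rcons.
have [x0h|x0h] := boolP ((x.1, ord0) \in rcons h x).
  have [v /andP[/eqP vx vh]|none] := pickP (fun v => (v.1 == x.1) && (v \notin rcons h x)).
    exists v; last by rewrite ansE vx eqxx x0h orbT.
    apply: (legal_T vh x0h cx); rewrite /blob /= vx eqxx orbT andbT.
    by apply: contraNneq vh => ->.
  have full v : v.1 = x.1 -> v \in rcons h x.
    by move=> vx; apply/negPn; have := none v; rewrite vx eqxx => /negbT.
  have /(congr1 odd) := count_column ux full.
  rewrite -cats1 count_cat /= eqxx oddD negbK (negbTE even_n).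
  by have := even_h x.1; case: odd.
exists (x.1, ord0); last by rewrite ansE /weighted /= !eqxx.
apply: (legal_T (y := x)) => //; first by rewrite mem_rcons inE eqxx.
rewrite /blob /= eqxx ?orbT andbT.
by apply: contraNneq x0h => ->; rewrite mem_rcons inE eqxx.
Qed.

(** After the first move, [x] needs a taken neighbour. The neighbours of a weighted vertex lie in
    its own column, and in every touched column the weighted vertex is already gone. *)
Lemma balanced_alice (h : seq V) (x : V) :
  balanced h -> legal_move GameT blob h x ->
  (alice_count weighted (rcons h x) <= 1)%N.
Proof.
move=> [_ _ _ wh ah] lx; rewrite alice_count_rcons.
have [xh _ _] := and3P lx.
case: h => [|a s] in wh ah lx xh *; first by move: ah => /=; case: (weighted x) => /=; lia.
suff /negbTE-> : ~~ weighted x by rewrite andbF addn0.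
apply: contra xh => /eqP wx.
have [u uh /andP[xu]] := legal_T_nbr lx (mem_head a s).
have -> : x = (x.1, ord0) by rewrite -wx; case: (x).
by rewrite /weighted eqxx /= => /eqP->; apply: wh.
Qed.

Lemma balanced_bob (h : seq V) (x y : V) :
  balanced h -> ~~ odd (size h) -> legal_move GameT blob h x ->
  legal_move GameT blob (rcons h x) y -> answer (rcons h x) y ->
  balanced (rcons (rcons h x) y).
Proof.
move=> bh even_sh lx ly ay; have aliceh := balanced_alice bh lx.
have [uh ch even_h wh _] := bh.
have [xh _ _] := and3P lx; have [yh cy _] := and3P ly.
have {ay} /andP[/eqP yx wy] :
    (y.1 == x.1) && (weighted y || ((x.1, ord0) \in rcons h x)).
  by move: ay; rewrite /answer; case: (h) => //= a s; rewrite last_rcons.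
have x0 : (x.1, ord0) \in rcons (rcons h x) y.
  rewrite mem_rcons inE; case/orP: wy => [/eqP wy|->]; last by rewrite orbT.
  by rewrite -wy -yx -surjective_pairing eqxx.
split.
- by rewrite !rcons_uniq yh xh.
- by move: cy.
- move=> i; rewrite -!cats1 !count_cat /= yx !addn0 -addnA addnn oddD odd_double addbF.
  exact: even_h.
- move=> v; rewrite mem_rcons inE => /predU1P[->|]; first by rewrite yx.
  rewrite mem_rcons inE => /predU1P[->//|vh].
  by rewrite !(mem_rcons, inE) wh ?orbT.
rewrite alice_count_rcons size_rcons /= negbK (negbTE even_sh) /= addn0.
by case: (rcons (rcons h x) y) (size_rcons (rcons h x) y).
Qed.

(** Right after Alice's move one column has odd count, so at odd lengths the invariant is stated for
    the history without that move. *)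
Lemma play_balanced (h : seq V) : play_against GameT blob sigma h ->
  if odd (size h) then
    exists h' x, [/\ h = rcons h' x, balanced h', ~~ odd (size h') &
      legal_move GameT blob h' x]
  else balanced h.
Proof.
elim=> {h} [|h x _ + even_h lx|h _ + odd_h lx].
- split=> //; last by rewrite alice_count_nil.
  by apply/forall_inP => x; rewrite inE.
- by rewrite size_rcons /= (negbTE even_h) => bh; exists h, x.
rewrite size_rcons /= odd_h => -[h' [x [eh bh even_h' lx']]]; subst h.
have [v lv av] := balanced_rcons bh even_h' lx'.
have /andP[ls as_] := prefer_good v0 lv av.
exact: balanced_bob.
Qed.

(** Shows that game T ends only with every vertex taken. A taken weightless vertex gives access to
    all weightless ones, and when these are all gone every weighted vertex is accessible. *)
Lemma legal_T_exists (h : seq V) (v : V) :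
  connected_on blob [set u in h] -> v \notin h -> exists x, legal_move GameT blob h x.
Proof.
move=> ch vh; case: h => [|a s] in ch vh *; first by exists v; apply: legal_T_nil.
set h := a :: s in ch vh *.
have [y yh|none] := pickP (fun y => (y \in h) && ~~ weighted y).
  have {yh}/andP[yh ny] := yh.
  have [x xh|all_in] := pickP (fun x => (x \notin h) && ~~ weighted x).
    have {xh}/andP[xh nx] := xh.
    exists x; apply: (legal_T xh yh ch); rewrite /blob /= nx ny.
    by rewrite orTb andbT; apply: contraNneq xh => ->.
  have v1 : (v.1, lift ord0 ord0) \in h.
    by have := all_in (v.1, lift ord0 ord0); rewrite /weighted /= andbT => /negbFE.
  exists v; apply: (legal_T vh v1 ch); rewrite /blob /= eqxx orbT andbT.
  by apply: contraNneq vh => ->.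
exists (a.1, lift ord0 ord0).
have ah : a \in h by rewrite mem_head.
have nh : (a.1, lift ord0 ord0) \notin h.
  by have := none (a.1, lift ord0 ord0); rewrite /weighted /= andbT => /negbT.
apply: (legal_T nh ah ch); rewrite /blob /= eqxx orbT andbT.
by apply: contraNneq nh => ->.
Qed.

Lemma game_T_over (h : seq V) :
  play_against GameT blob sigma h -> game_over GameT blob h ->
  (forall v, weighted v -> v \in h) /\ (alice_count weighted h <= 1)%N.
Proof.
move=> ph over; have := play_balanced ph => inv.
have [ch ac] : connected_on blob [set v in h] /\ (alice_count weighted h <= 1)%N.
  case: ifP inv => _ => [[h' [x [-> bh _ lx]]]|[_ ch _ _ ah]].
    by split; [case/and3P: lx | apply: balanced_alice].
  by split=> //; apply: leq_trans ah (leq_b1 _).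
split=> // v _; apply/negPn/negP => vh.
by have [x lx] := legal_T_exists ch vh; have := over x; rewrite lx.
Qed.

End GameT.

Lemma bob_wins_T (R : realType) (eps : R) (k : nat) :
  0 < eps ->
  exists (V : finType) (e : rel V) (w : V -> R),
    [/\ simple_graph e,
        k_connected e k,
        (forall v, 0 <= w v),
        0 < \sum_(v : V) w v &
        bob_can_obtain GameT e w ((1 - eps) * \sum_(v : V) w v)].
Proof.
(* [m] exceeds the inverse of [eps], so one weighted vertex is at most an [eps] fraction; [n] is
   even for the column parity and at least [k] for the connectivity. *)
move=> eps0; pose m := (Num.bound eps^-1).+1; pose n := k.*2.
exists ('I_m * 'I_n.+2)%type, (@blob m n), (fun v => (weighted v)%:R).
have cw : (m <= #|@weighted m n|)%N.
  rewrite -[X in (X <= _)%N]card_ord -(card_imset predT (f := fun i => (i, ord0 : 'I_n.+2))).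
    by apply/subset_leq_card/subsetP => _ /imsetP[i _ ->]; rewrite unfold_in.
  by move=> i j [].
split.
- by split; [exact: blob_sym | move=> u; rewrite /blob /= eqxx].
- by apply: blob_k_connected => //; rewrite /n -addnn leq_addr.
- by move=> v; apply: ler0n.
- rewrite -natr_sum ltr0n; apply: leq_trans (_ : m <= _)%N => //.
  apply: leq_trans cw _.
  by rewrite -sum1_card big_mkcond leq_sum.
apply: (@bob_can_obtain_of_count _ _ _ _ _ _ 1 (prefer GameT (@blob m n) (@answer m n) (ord0, ord0))).
- exact: prefer_strategy.
- by apply: game_T_over; rewrite odd_double.
rewrite -ler_pdivrMl // mulr1; apply: ltW; apply: lt_le_trans (archi_boundP _) _.
  by rewrite invr_ge0 ltW.
by rewrite ler_nat (leq_trans _ cw).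
Qed.

(** * Games R and TR *)

Definition xor_diff (f : nat -> bool) : nat -> bool :=
  fun s => f s (+) f s.+1.

Lemma iter_xor_diff0 (r : nat) (f : nat -> bool) (s : nat) :
  (forall s, f s = false) -> iter r xor_diff f s = false.
Proof.
by move=> f0; elim: r s => //= r IH s; rewrite /xor_diff !IH.
Qed.

(** With [E] the shift, [xor_diff] is 1 + E over the field with two elements, where (1 + E)^(2^j) =
    1 + E^(2^j). *)
Lemma iter_xor_diff_pow2 (j : nat) (f : nat -> bool) (s : nat) :
  iter (2 ^ j) xor_diff f s = f s (+) f (s + 2 ^ j)%N.
Proof.
elim: j f s => [|j IH] f s; first by rewrite expn0 addn1.
rewrite expnS mul2n -addnn iterD !IH addnA.
by rewrite addbA addbK.
Qed.

Lemma odd_cardsU (T : finType) (A B : {set T}) :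
  [disjoint A & B] -> odd #|A :|: B| = odd #|A| (+) odd #|B|.
Proof. by move=> dAB; rewrite cardsU (disjoint_setI0 dAB) cards0 subn0 oddD. Qed.

Lemma setD1_eq (I : finType) (l : I) (A U : {set I}) :
  l \notin U -> (A :\ l == U) = (A == U) || (A == l |: U).
Proof.
move=> lU; apply/eqP/orP => [<-|[/eqP->|/eqP->]]; last exact: setU1K.
- have [lA|lA] := boolP (l \in A); first by right; rewrite setD1K.
  by left; apply/eqP/setP => i; rewrite !inE; case: eqVneq => //= ->; apply: negbTE.
- by apply/setP => i; rewrite !inE; case: eqVneq => //= ->; rewrite (negbTE lU).
Qed.

(* Removing an element of [T] splits the fibre over [U] into two fibres, over
   sets of sizes [#|U|] and [#|U|.+1]. *)
Lemma odd_card_setD_fiber (I : finType) (f : nat -> bool) (T U : {set I}) :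
  [disjoint T & U] ->
  odd #|[set S : {set I} | f #|S| && (S :\: T == U)]| =
  iter #|T| xor_diff f #|U|.
Proof.
move En: #|T| => n; elim: n T U En => [|n IH] T U En dTU.
  rewrite (cards0_eq En).
  rewrite (_ : [set _ | _] = if f #|U| then [set U] else set0).
    by case: ifP; rewrite ?cards1 ?cards0 //= => ->.
  apply/setP => S; rewrite !inE setD0; have [->|nSU] := eqVneq S U.
    by case: ifP; rewrite !inE ?eqxx ?andbT.
  by case: ifP; rewrite !inE ?(negbTE nSU) ?andbF.
have /set0Pn[l lT] : T != set0 by rewrite -card_gt0 En.
have lU : l \notin U by rewrite (disjointFr dTU).
have En' : #|T :\ l| = n by move: En; rewrite (cardsD1 l) lT => -[].
have dT'U : [disjoint T :\ l & U] by apply: disjointWl dTU; apply: subsetDl.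
rewrite (_ : [set _ | _] = [set S : {set I} | f #|S| && (S :\: (T :\ l) == U)]
    :|: [set S : {set I} | f #|S| && (S :\: (T :\ l) == l |: U)]).
  rewrite odd_cardsU; last first.
    apply/pred0P => S; rewrite /= !inE; apply/negP => /andP[/andP[_ /eqP->] /andP[_]].
    by move/eqP/setP/(_ l); rewrite setU11 (negbTE lU).
  rewrite !IH //=; last first.
    rewrite disjoints_subset; apply/subsetP => i; rewrite !inE => /andP[nil iT].
    by rewrite negb_or nil (disjointFr dTU).
  by rewrite /xor_diff cardsU1 lU.
apply/setP => S; rewrite !inE -andb_orr; congr (_ && _).
have DE : S :\: T = (S :\: (T :\ l)) :\ l.
  by apply/setP => i; rewrite !inE; case: eqVneq => // ->; rewrite lT.
by rewrite DE setD1_eq.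
Qed.

(** The size condition has period [2 ^ j], so it vanishes after [2 ^ j] differences and stays zero
    under further ones. *)
Lemma even_card_setD_fiber (I : finType) (j : nat) (T U : {set I}) :
  [disjoint T & U] -> (2 ^ j <= #|T|)%N ->
  odd #|[set S : {set I} | (#|S| == 1 %[mod 2 ^ j]) && (S :\: T == U)]| = false.
Proof.
move=> dTU jT.
rewrite (odd_card_setD_fiber (fun s => s == 1 %[mod 2 ^ j]) dTU) -(subnK jT) iterD.
apply: iter_xor_diff0 => s.
by rewrite iter_xor_diff_pow2 modnDr addbb.
Qed.

(** * The lock graph and its connectivity *)

Section LockGraph.
Variables (a m j : nat).
Hypotheses (a_gt0 : (0 < a)%N) (a_small : (2 * a < 2 ^ j)%N).
Local Notation t := (2 ^ j)%N.
Local Fact t_gt1 : (1 < t)%N.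
Proof. by case: (2 ^ j)%N a_small => [|[|]]; lia. Qed.
Local Notation V := ('I_a + {S : {set 'I_m} | #|S| == 1 %[mod 2 ^ j]})%type.

(* The left summand consists of the hubs; in the right one the singletons are
   the coins and the larger sets the locks. *)
Definition support (v : V) : {set 'I_m} := if v is inr A then val A else set0.

Definition hub (v : V) : bool := #|support v| == 0%N.
Definition coin (v : V) : bool := #|support v| == 1%N.
Definition core (v : V) : bool := (#|support v| <= 1)%N.

(** One inclusion rule serves hubs and coins alike: a hub has empty support and so is adjacent to
    every other vertex. Two locks are never adjacent. *)
Definition lock_rel : rel V :=
  [rel u v | (u != v) && [|| core u && core v,
     core u && (support u \subset support v) |
     core v && (support v \subset support u)]].

Lemma coin_proof (l : 'I_m) : #|[set l]| == 1 %[mod 2 ^ j].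
Proof. by rewrite cards1. Qed.

Definition coin_at (l : 'I_m) : V := inr (exist _ [set l] (coin_proof l)).

Lemma support_coin_at (l : 'I_m) : support (coin_at l) = [set l].
Proof. by []. Qed.

Lemma coin_coin_at (l : 'I_m) : coin (coin_at l).
Proof. by rewrite /coin support_coin_at cards1. Qed.

Lemma coin_at_inj : injective coin_at.
Proof. by move=> l l' /(congr1 support); rewrite !support_coin_at => /set1_inj. Qed.

Lemma coinP (v : V) : reflect (exists l, v = coin_at l) (coin v).
Proof.
apply: (iffP idP) => [/cards1P[l E]|[l ->]]; last exact: coin_coin_at.
exists l; case: v E => [i /= /setP/(_ l)|A E]; first by rewrite !inE eqxx.
by congr inr; apply: val_inj.
Qed.

Lemma core_coin (v : V) : coin v -> core v.
Proof. by rewrite /core => /eqP->. Qed.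

Lemma core_hub (v : V) : hub v -> core v.
Proof. by rewrite /core => /eqP->. Qed.

Lemma coreE (v : V) : core v = hub v || coin v.
Proof. by rewrite /core /hub /coin; case: #|_| => [|[|]]. Qed.

Lemma hub_inl (v : V) : hub v = if v is inl _ then true else false.
Proof.
rewrite /hub; case: v => [i|[A hA]] /=; first by rewrite cards0.
apply: contraTF hA => /eqP->; by rewrite mod0n modn_small // t_gt1.
Qed.

(** A size above 1 and congruent to 1 modulo [t] is at least [t + 1]. Hence [t] taken coins never
    exhaust a lock. *)
Lemma lock_large (v : V) : ~~ core v -> (t < #|support v|)%N.
Proof.
rewrite /core -ltnNge; case: v => [i|[A hA]] /=; first by rewrite cards0.
move=> A1; move/eqP: hA; rewrite (modn_small t_gt1) => Amod.
move: A1; rewrite [#|A|](divn_eq _ t) Amod; case: (_ %/ _)%N => [//|q] _.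
by rewrite addn1 ltnS mulSn leq_addr.
Qed.

Local Arguments support : simpl never.

Lemma lock_sym : symmetric lock_rel.
Proof.
move=> u v; rewrite /lock_rel /= (eq_sym v) (andbC (core v) (core u)).
by congr (_ && (_ || _)); rewrite orbC.
Qed.

Lemma hub_adj (u v : V) : hub u -> u != v -> lock_rel u v.
Proof.
move=> hu uv; rewrite /lock_rel /= uv core_hub //=.
by move: hu; rewrite /hub cards_eq0 => /eqP->; rewrite sub0set orbT.
Qed.

Lemma core_adj (u v : V) : core u -> core v -> u != v -> lock_rel u v.
Proof. by move=> cu cv uv; rewrite /lock_rel /= uv cu cv. Qed.

Lemma lock_adj (v u : V) : ~~ core v -> lock_rel v u -> core u && (support u \subset support v).
Proof. by rewrite /lock_rel /= => /negbTE-> /andP[_]. Qed.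

Lemma lock_coin_adj (v : V) (l : 'I_m) :
  ~~ core v -> l \in support v -> lock_rel v (coin_at l).
Proof.
move=> nv lv; rewrite /lock_rel /= (core_coin (coin_coin_at l)) /= support_coin_at sub1set lv !orbT andbT.
by apply: contraNneq nv => ->; rewrite core_coin ?coin_coin_at.
Qed.

Definition coins (H : {set V}) : {set 'I_m} := [set l | coin_at l \in H].

Lemma coinsU1 (H : {set V}) (v : V) :
  coins (v |: H) = if coin v then support v :|: coins H else coins H.
Proof.
case: ifP => [/coinP[l ->]|nv]; apply/setP => i; rewrite !inE.
  by rewrite (inj_eq coin_at_inj).
by case: eqP => // E; rewrite -E coin_coin_at in nv.
Qed.

Lemma card_coins (H : {set V}) : (#|coins H| <= #|H|)%N.
Proof.
rewrite -(card_imset _ coin_at_inj); apply/subset_leq_card/subsetP.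
by move=> _ /imsetP[l + ->]; rewrite inE.
Qed.

Lemma lock_connected (H : {set V}) :
  (forall v, v \notin H -> ~~ core v -> exists2 u, u \notin H & core u && lock_rel v u) ->
  connected_on lock_rel (~: H).
Proof.
move=> nbr; apply: (connected_on_hub (B := core)) lock_sym core_adj _ => v.
by rewrite inE => vH /(nbr v vH)[u uH uP]; exists u; rewrite ?inE.
Qed.

Lemma lock_connected_few (H : {set V}) :
  (#|coins H| <= t)%N -> connected_on lock_rel (~: H).
Proof.
move=> few; apply: lock_connected => v vH nv.
have /subsetPn[l lv lH] : ~~ (support v \subset coins H).
  by apply/negP => /subset_leq_card; have := lock_large nv; lia.
exists (coin_at l); first by move: lH; rewrite inE.
by rewrite lock_coin_adj // core_coin ?coin_coin_at.
Qed.

(** The untaken coin is a second remaining vertex, so a remaining lock is not isolated, and all its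
    neighbours are in the core. *)
Lemma lock_nbr (H : {set V}) (v : V) (l : 'I_m) :
  connected_on lock_rel (~: H) -> l \notin coins H -> v \notin H -> ~~ core v ->
  exists2 u, u \notin H & core u && (support u \subset support v) && lock_rel v u.
Proof.
move=> cH lH vH nv; have [|||u] := connected_on_nbr (v := v) (w := coin_at l) cH.
- by rewrite inE.
- by move: lH; rewrite !inE.
- by apply: contraNneq nv => ->; rewrite core_coin ?coin_coin_at.
by rewrite inE => uH vu; exists u; rewrite // lock_adj.
Qed.

Lemma hub_connected (H : {set V}) (z : V) :
  hub z -> z \in H -> connected_on lock_rel H.
Proof.
move=> hz zH; apply: (connected_on_hub (B := pred1 z)) lock_sym _ _.
  by move=> u v /eqP-> /eqP->; rewrite eqxx.
move=> v vH vz; exists z => //=; rewrite eqxx lock_sym hub_adj //.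
by rewrite eq_sym.
Qed.

(** * Groups of remaining vertices and their parity *)

Definition hubs_taken (H : {set V}) : bool := [forall v, hub v ==> (v \in H)].

Definition group (H : {set V}) (U : {set 'I_m}) : {set V} :=
  [set v | [&& v \notin H, ~~ hub v & support v :\: coins H == U]].

Definition odd_groups (H : {set V}) : {set {set 'I_m}} :=
  [set U | odd #|group H U|].

(** With the taken vertices included, a group is a whole fibre of the map removing the taken coins,
    over all sets of size 1 modulo [t]. *)
Lemma card_group0 (H : {set V}) (U : {set 'I_m}) :
  (t <= #|coins H|)%N ->
  odd #|[set v : V | ~~ hub v && (support v :\: coins H == U)]| = false.
Proof.
move=> tH; have [dU|] := boolP [disjoint coins H & U]; last first.
  case/pred0Pn => l /= /andP[lH lU]; rewrite (_ : [set _ | _] = set0) ?cards0 //.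
  apply/setP => v; rewrite !inE; apply/negP => /andP[_ /eqP/setP/(_ l)].
  by rewrite in_setD lH lU.
rewrite -(even_card_setD_fiber dU tH); congr (odd _).
rewrite -(card_in_imset (f := support)) => [|u v]; last first.
  rewrite !inE !hub_inl; case: u v => [i //|A] [i //|B] _ _ /= E.
  by congr inr; apply: val_inj.
apply: eq_card => S; apply/imsetP/idP => [[v]|].
  by rewrite !inE hub_inl; case: v => [//|B] /andP[_ /= SU] ->; rewrite (valP B).
rewrite inE => /andP[hS SU]; exists (inr (exist _ S hS)) => //.
by rewrite inE hub_inl.
Qed.

(** Whole fibres are even, so an odd group has lost some taken vertex; different groups lose
    different vertices. *)
Lemma odd_groups_small (H : {set V}) :
  (t <= #|coins H|)%N -> (#|odd_groups H| <= #|H|)%N.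
Proof.
move=> tH; apply: leq_trans (leq_imset_card (fun v => support v :\: coins H) _).
apply/subset_leq_card/subsetP => U; rewrite inE => oddU.
have := card_group0 U tH; set F := [set v | _] => evenF.
have /set0Pn[v] : F :&: H != set0.
  apply: contraTneq oddU => FH; rewrite (_ : group H U = F) ?evenF //.
  apply/setP => v; have /setP/(_ v) := FH; rewrite !inE.
  by case: (v \in H); rewrite ?andbT ?andbF // => ->.
rewrite !inE => /andP[/andP[_ /eqP <-] vH].
by apply/imsetP; exists v.
Qed.

Lemma group_lock (H : {set V}) (v : V) (U : {set 'I_m}) :
  ~~ core v -> group (v |: H) U = group H U :\ v.
Proof.
rewrite coreE negb_or => /andP[_ /negbTE nv].
by apply/setP => u; rewrite !inE coinsU1 nv negb_or -!andbA.
Qed.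

(** Only the group containing [v] can change parity. *)
Lemma odd_groups_lock (H : {set V}) (v : V) :
  ~~ core v -> (#|odd_groups (v |: H)| <= #|odd_groups H|.+1)%N.
Proof.
move=> nv; apply: (@leq_trans #|support v :\: coins H |: odd_groups H|); last first.
  by rewrite cardsU1; case: (_ \notin _).
apply/subset_leq_card/subsetP => U; rewrite !inE group_lock // (cardsD1 v (group H U)).
case: (boolP (v \in group H U)) => [|_ ->]; last by rewrite orbT.
by rewrite inE => /and3P[_ _ /eqP<-]; rewrite eqxx.
Qed.

Lemma odd_groups_odd_lock (H : {set V}) (v : V) :
  v \notin H -> ~~ core v -> odd #|group H (support v :\: coins H)| ->
  (#|odd_groups (v |: H)| < #|odd_groups H|)%N.
Proof.
move=> vH nv oddv; set U := support v :\: coins H.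
have vU : v \in group H U.
  by rewrite inE vH eqxx andbT /=; apply: contra nv; apply: core_hub.
rewrite [X in (_ < X)%N](cardsD1 U) inE oddv ltnS.
apply/subset_leq_card/subsetP => U'; rewrite !inE group_lock //.
have [->|nU] := eqVneq U' U.
  by move: oddv; rewrite (cardsD1 v (group H U)) vU /= => /negbTE->.
rewrite (cardsD1 v (group H U')) (_ : v \in _ = false) //.
by rewrite inE -/U eq_sym (negbTE nU) !andbF.
Qed.

(* Taking [coin_at l] merges every group [l |: U] into [U]; a merged group is odd
   only if one of its two parts was. *)
Lemma odd_groups_coin (H : {set V}) (l : 'I_m) :
  l \notin coins H -> group H [set l] = [set coin_at l] ->
  (#|odd_groups (coin_at l |: H)| < #|odd_groups H|)%N.
Proof.
move=> lH gl; rewrite [X in (_ < X)%N](cardsD1 [set l]) inE gl cards1 ltnS.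
apply: leq_trans (leq_imset_card (fun U => U :\ l) _).
have coinsE : coins (coin_at l |: H) = l |: coins H.
  by rewrite coinsU1 coin_coin_at.
apply/subset_leq_card/subsetP => U; rewrite inE => oddU.
have /set0Pn[v] : group (coin_at l |: H) U != set0.
  by apply: contraTneq oddU => ->; rewrite cards0.
rewrite inE coinsE => /and3P[_ _ /eqP vU].
have lU : l \notin U by rewrite -vU !inE eqxx.
have gE : group (coin_at l |: H) U = (group H U :|: group H (l |: U)) :\ coin_at l.
  apply/setP => u; rewrite !inE coinsE negb_or -!andbA -!andb_orr -setD1_eq //.
  by rewrite setDDl (setUC _ [set l]).
have gD W : W != [set l] -> group H W :\ coin_at l = group H W.
  move=> Wl; apply/setDidPl; rewrite disjoint_sym disjoints1 inE support_coin_at.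
  apply/negP => /and3P[_ _ /eqP E]; case/eqP: Wl; rewrite -E.
  by apply/setDidPl; rewrite disjoints1.
(* For [U] empty, the second part is the group of [[set l]], which is excluded from the count; its
   only member is the coin being taken, so the odd part is the group of [set0]. *)
have [U0|U0] := eqVneq U set0.
  have lU0 : set0 != [set l] by rewrite eq_sym -cards_eq0 cards1.
  apply/imsetP; exists set0; last by rewrite U0 set0D.
  move: oddU; rewrite gE U0 setU0 gl setDUl setDv setU0 gD // !inE => ->.
  by rewrite lU0.
have UlN : l |: U != [set l].
  apply: contraNneq U0 => E; apply/eqP/setP => i; rewrite inE.
  by have /setP/(_ i) := E; rewrite !inE; case: eqVneq => //= ->; rewrite (negbTE lU).
have UN : U != [set l] by apply: contraNneq lU => ->; rewrite set11.
have dis : [disjoint group H U & group H (l |: U)].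
  apply/pred0P => u; rewrite /= !inE; apply/negP => /andP[/and3P[_ _ /eqP->] /and3P[_ _]].
  by move/eqP/setP/(_ l); rewrite setU11 (negbTE lU).
move: oddU; rewrite gE setDUl !gD // odd_cardsU //.
have [oddU _|_ /= oddlU] := boolP (odd #|group H U|); apply/imsetP.
  exists U; rewrite ?inE ?UN //.
  by apply/setP => i; rewrite !inE; case: eqVneq => //= ->; rewrite (negbTE lU).
by exists (l |: U); rewrite ?inE ?UlN // setU1K.
Qed.

Definition hub_count (H : {set V}) : nat := #|[set v in H | hub v]|.

Lemma hub_count_le (H : {set V}) : (hub_count H <= a)%N.
Proof.
rewrite -[X in (_ <= X)%N]card_ord -(card_imset predT (f := inl : 'I_a -> V)) => [|x y []//].
apply/subset_leq_card/subsetP => v; rewrite inE hub_inl => /andP[_].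
by case: v => // i _; apply/imsetP; exists i.
Qed.

Lemma hub_countU1 (H : {set V}) (v : V) :
  v \notin H -> hub_count (v |: H) = (hub_count H + hub v)%N.
Proof.
move=> vH; rewrite /hub_count (cardsD1 v) addnC !inE eqxx /=; congr (_ + _)%N.
apply: eq_card => u; rewrite !inE; case: eqVneq => //= ->.
by rewrite (negbTE vH).
Qed.

Lemma card_coinsU1 (H : {set V}) (v : V) :
  v \notin H -> #|coins (v |: H)| = (#|coins H| + coin v)%N.
Proof.
move=> vH; rewrite coinsU1; case: ifP => [/coinP[l E]|_]; last by rewrite addn0.
by rewrite E support_coin_at cardsU1 inE -E vH addnC.
Qed.

Lemma hubs_takenU1 (H : {set V}) (v : V) : hubs_taken H -> hubs_taken (v |: H).
Proof.
move=> /forallP hH; apply/forallP => u; apply/implyP => hu.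
by rewrite inE (implyP (hH u) hu) orbT.
Qed.

Lemma coins_neqT (H : {set V}) : coins H != setT -> exists l, l \notin coins H.
Proof. by rewrite -subTset => /subsetPn[l _ lH]; exists l. Qed.

(** * Bob's strategy in the lock graph and its invariant *)

Variable g : game.
Hypotheses (gR : requires_R g) (t_lt_m : (t < m)%N) (even_V : ~~ odd #|{: V}|).

Lemma few_coins_neqT (H : {set V}) : (#|coins H| <= t)%N -> coins H != setT.
Proof.
by apply: contraTneq => ->; rewrite cardsT card_ord -ltnNge.
Qed.

Definition greedy (h : seq V) (v : V) : bool :=
  let H := [set u in h] in
  if ~~ hubs_taken H then hub v
  else if (#|coins H| < t)%N then coin v
  else odd #|group H (support v :\: coins H)|.

Definition first_hub : V := inl (Ordinal a_gt0).

Lemma hub_first_hub : hub first_hub.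
Proof. by rewrite hub_inl. Qed.

(** When the opening ends, at most [2 * (a + t) + 2] vertices are taken. This bounds both the number
    of odd groups and twice the number of Alice's coins, and [bound] exceeds the sum. *)
Local Notation bound := (4 * (a + t) + 5)%N.

(** [inv_hubs] and [inv_coins] record that in the opening every move of Bob takes a hub, later a hub
    or a coin. The left side of [inv_groups] is a potential: a move of Alice raises it by at most 1,
    since a coin adds 2 but destroys an odd group, and a move of Bob lowers it by at least 1. The
    extra 2 in [inv_alice] pays for a last coin of Alice, after which [inv_groups] is silent. *)
Record lock_inv (h : seq V) : Prop := LockInv {
  inv_uniq : uniq h;
  inv_conn : connected_on lock_rel (~: [set v in h]);
  inv_hubs : ~~ hubs_taken [set v in h] ->
    (size h <= 2 * hub_count [set v in h] + odd (size h))%N;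
  inv_coins : (#|coins [set v in h]| < t)%N ->
    (size h <= 2 * (hub_count [set v in h] + #|coins [set v in h]|)
      + odd (size h))%N;
  inv_groups : hubs_taken [set v in h] -> (t <= #|coins [set v in h]|)%N ->
    coins [set v in h] != setT ->
    (#|odd_groups [set v in h]| + 2 * alice_count coin h
      <= bound + odd (size h))%N;
  inv_alice : (2 * alice_count coin h <= bound + 2)%N }.

Lemma lock_inv_nil : lock_inv [::].
Proof.
split=> //.
- apply: lock_connected_few; rewrite (_ : coins _ = set0) ?cards0 //.
  by apply/setP => i; rewrite !inE.
- move=> _; rewrite (_ : coins _ = set0) ?cards0; first by rewrite leqNgt expn_gt0.
  by apply/setP => i; rewrite !inE.
by rewrite alice_count_nil.
Qed.

Lemma card_hist (h : seq V) : uniq h -> #|[set v in h]| = size h.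
Proof. by move=> uh; rewrite cardsE; apply/card_uniqP. Qed.

(** While a hub remains, at most [2 * a + 1] moves have been made, and [2 * a < t]. *)
Lemma lock_inv_coins_few (h : seq V) :
  lock_inv h -> ~~ hubs_taken [set v in h] -> (#|coins [set v in h]| <= t)%N.
Proof.
move=> inv nh; apply: leq_trans (card_coins _) _; rewrite card_hist ?(inv_uniq inv) //.
have := inv_hubs inv nh; have := hub_count_le [set v in h]; have := leq_b1 (odd (size h)).
by move: a_small; clear; lia.
Qed.

Lemma lock_inv_size (h : seq V) :
  lock_inv h -> ~~ hubs_taken [set v in h] || (#|coins [set v in h]| < t)%N ->
  (size h <= 2 * (a + t) + 1)%N.
Proof.
move=> inv; have := hub_count_le [set v in h]; have := leq_b1 (odd (size h)).
by move=> b1 hc /orP[/(inv_hubs inv)|ct]; [|have := inv_coins inv ct; move: ct]; move: b1 hc; clear; lia.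
Qed.

(** Another member of the group would be a lock whose only untaken coin is [l]. With the hubs gone,
    taking [l] would isolate it from the coins that remain. *)
Lemma group_coin (H : {set V}) (l : 'I_m) :
  hubs_taken H -> coin_at l \notin H -> coins (coin_at l |: H) != setT ->
  connected_on lock_rel (~: (coin_at l |: H)) ->
  group H [set l] = [set coin_at l].
Proof.
move=> hH lH /coins_neqT[i iH'] cH'; apply/setP => u; rewrite !inE.
apply/and3P/eqP => [[uH nu /eqP key]|->]; last first.
  rewrite lH support_coin_at; split=> //; first by rewrite /hub support_coin_at cards1.
  by apply/eqP/setDidPl; rewrite disjoints1 inE.
have [/coinP[l' E]|nc] := boolP (coin u).
  rewrite E; congr coin_at; apply/set1P; rewrite -key in_setD E support_coin_at set11 andbT.
  by rewrite inE -E.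
have ncu : ~~ core u by rewrite coreE negb_or nu nc.
have uH' : u \notin coin_at l |: H.
  by rewrite in_setU1 negb_or uH andbT; apply: contraNneq nc => ->; apply: coin_coin_at.
have [w wH' /andP[/andP[cw wu] _]] := lock_nbr cH' iH' uH' ncu.
have /coinP[l' E] : coin w.
  move: cw; rewrite coreE => /orP[hw|//].
  by move/forallP/(_ w)/implyP/(_ hw): hH => wH; rewrite in_setU1 wH orbT in wH'.
move: wH'; rewrite in_setU1 E negb_or => /andP[l'l l'H].
have : l' \in support u :\: coins H.
  rewrite in_setD inE l'H /=; apply: (subsetP wu); by rewrite E support_coin_at set11.
by rewrite key => /set1P l'E; rewrite l'E eqxx in l'l.
Qed.

(** Serves both players: the preference is assumed at Bob's turns only, and only while coins
    remain. *)
Lemma lock_inv_rcons (h : seq V) (v : V) :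
  lock_inv h -> legal_move g lock_rel h v ->
  (odd (size h) -> coins [set u in h] != setT -> greedy h v) ->
  lock_inv (rcons h v).
Proof.
move=> inv /and3P[vh _]; rewrite gR /= => cH' grd.
have setE : [set u in rcons h v] = v |: [set u in h] := set_rcons h v.
have vH : v \notin [set u in h] by rewrite inE.
have ac := alice_count_rcons coin h v.
have acs : (2 * alice_count coin h <= size h + odd (size h))%N := alice_count_size coin h.
have acs' : (2 * alice_count coin (rcons h v) <= size (rcons h v) + odd (size (rcons h v)))%N :=
  alice_count_size coin (rcons h v).
have ux : uniq (rcons h v) by rewrite rcons_uniq vh inv_uniq.
have cardH' := card_hist ux.
rewrite setE in cH' cardH'; rewrite size_rcons in acs' cardH'.
split; rewrite ?setE ?size_rcons //.
- move=> nH'; have nH : ~~ hubs_taken [set u in h].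
    by apply: contra nH'; apply: hubs_takenU1.
  have := inv_hubs inv nH; rewrite hub_countU1 //=.
  have := grd; rewrite /greedy nH; have := few_coins_neqT (lock_inv_coins_few inv nH).
  by case: (odd _) => /= [nT /(_ isT nT) ->|_ _] /=; clear; lia.
- rewrite card_coinsU1 // => ct'.
  have ct : (#|coins [set u in h]| < t)%N by apply: leq_ltn_trans ct'; apply: leq_addr.
  have hc : odd (size h) -> hub v || coin v.
    move=> odd_h; have := grd odd_h (few_coins_neqT (ltnW ct)); rewrite /greedy ct.
    by case: ifP => _ ->; rewrite ?orbT.
  have := inv_coins inv ct; rewrite hub_countU1 //= => IH.
  case: (odd _) hc IH => /= [/(_ isT)|_]; last by (clear; lia).
  by case: (hub v); case: (coin v) => //=; clear; lia.
- move=> hH' ct' nT'.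
  have nT : coins [set u in h] != setT.
    apply: contra nT' => /eqP cT; rewrite coinsU1 cT.
    by case: ifP; rewrite ?setUT.
  (* Either this move ends the opening and the number of moves bounds everything, or the potential
     was already under control. *)
  have [/(lock_inv_size inv)|] := boolP (~~ hubs_taken [set u in h] || (#|coins [set u in h]| < t)%N).
    have := odd_groups_small ct'; rewrite cardH'; move: acs' => /=.
    by case: (odd _) => /=; clear; lia.
  rewrite negb_or negbK -leqNgt => /andP[hH ct].
  have nhv : ~~ hub v.
    by apply: contra vH => hv; move/forallP/(_ v)/implyP: hH; apply.
  have := inv_groups inv hH ct nT; rewrite ac.
  have [/coinP[l E]|ncv] := boolP (coin v).
    rewrite E in vH cH' nT' *.
    have lH : l \notin coins [set u in h] by rewrite inE.
    have := odd_groups_coin lH (group_coin hH vH nT' cH').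
    by rewrite /=; case: (odd _); clear; lia.
  have ncrv : ~~ core v by rewrite coreE negb_or nhv ncv.
  rewrite andbF addn0 /=.
  have := odd_groups_lock [set u in h] ncrv.
  move: grd; rewrite /greedy hH /= ltnNge ct /=.
  case: (odd (size h)) => /= [/(_ isT nT) grd _|_]; last by (clear; lia).
  rewrite addn1 addn0 => IH; rewrite -ltnS; apply: leq_trans IH.
  by rewrite ltn_add2r odd_groups_odd_lock.
rewrite ac; have := inv_alice inv; case even_h: (odd (size h)) => /=; first by (clear; lia).
have [/coinP[l E] _|_] := boolP (coin v); last by (clear; lia).
have nT : coins [set u in h] != setT.
  apply: contra vH => /eqP cT; have : l \in coins [set u in h] by rewrite cT inE.
  by rewrite inE E.
have [/(lock_inv_size inv)|] := boolP (~~ hubs_taken [set u in h] || (#|coins [set u in h]| < t)%N).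
  by move: acs; rewrite even_h /=; clear; lia.
rewrite negb_or negbK -leqNgt => /andP[hH ct].
by have := inv_groups inv hH ct nT; rewrite even_h /=; clear; lia.
Qed.

Lemma legal_lock (h : seq V) (v : V) :
  v \notin h -> connected_on lock_rel (~: (v |: [set u in h])) ->
  hub v || hubs_taken [set u in h] -> legal_move g lock_rel h v.
Proof.
move=> vh cH' hv; rewrite /legal_move vh set_rcons gR /= cH' andbT.
(* A taken hub is adjacent to everything, so rule (T) holds by itself. *)
apply/implyP => _; have [hub_v|nhv] := boolP (hub v).
  by apply: (hub_connected hub_v); rewrite setU11.
apply: (hub_connected hub_first_hub); rewrite (negbTE nhv) in hv.
by move/forallP/(_ first_hub)/implyP/(_ hub_first_hub): hv => fH; rewrite inE fH orbT.
Qed.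

Lemma legal_hub (h : seq V) :
  lock_inv h -> ~~ hubs_taken [set u in h] ->
  exists2 z, legal_move g lock_rel h z & hub z.
Proof.
move=> inv nh; have /forallPn[z] := nh; rewrite negb_imply => /andP[hz zH].
exists z => //; apply: legal_lock; rewrite ?hz //; first by rewrite inE in zH.
apply: lock_connected_few; rewrite card_coinsU1 // (_ : coin z = false) ?addn0.
  exact: lock_inv_coins_few.
by move: hz; rewrite /coin /hub => /eqP->.
Qed.

(** Removing a lock costs no other lock a neighbour, because locks have core neighbours only. *)
Lemma legal_noncore (h : seq V) (v : V) :
  connected_on lock_rel (~: [set u in h]) -> hubs_taken [set u in h] ->
  coins [set u in h] != setT -> v \notin h -> ~~ core v ->
  legal_move g lock_rel h v.
Proof.
move=> cH hH /coins_neqT[l lH] vh nv; apply: legal_lock; rewrite ?hH ?orbT //.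
apply: lock_connected => u uH' nu.
have uH : u \notin [set w in h] by apply: contra uH' => uH; rewrite in_setU1 uH orbT.
have [w wH /andP[/andP[cw _] uw]] := lock_nbr cH lH uH nu.
exists w; rewrite ?cw // in_setU1 negb_or wH andbT.
by apply: contraNneq nv => <-.
Qed.

(** An even total minus an odd number of moves leaves an odd number of vertices, and with the hubs
    gone the groups partition them. *)
Lemma odd_group_exists (h : seq V) :
  uniq h -> odd (size h) -> hubs_taken [set u in h] ->
  exists U, odd #|group [set u in h] U|.
Proof.
move=> uh odd_h hH; apply/existsP; apply: contraLR (odd_h).
rewrite negb_exists => /forallP even_groups.
have : ~~ odd #|~: [set u in h]|.
  rewrite -sum1_card (partition_big (fun v => support v :\: coins [set u in h]) xpredT) //=.
  apply: (big_ind (fun n => ~~ odd n)) => // [x y|U _]; first by rewrite oddD; case: odd.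
  rewrite sum1_card; rewrite (_ : #|_| = #|group [set u in h] U|) //.
  apply: eq_card => v; rewrite !inE unfold_in /= !inE andbA; congr (_ && _).
  have [hv|_] := boolP (hub v); last by rewrite andbT.
  by move/forallP/(_ v)/implyP/(_ hv): hH; rewrite inE => ->.
move: even_V; rewrite -(cardsC [set u in h]) oddD card_hist //.
by case: odd => //=; case: odd.
Qed.

Lemma greedy_exists (h : seq V) :
  lock_inv h -> odd (size h) -> coins [set u in h] != setT ->
  exists2 v, legal_move g lock_rel h v & greedy h v.
Proof.
move=> inv odd_h nT; have cH := inv_conn inv; rewrite /greedy.
have [hH|nH] /= := boolP (hubs_taken [set u in h]); last exact: legal_hub.
have [ct|ct] := ltnP #|coins [set u in h]| t.
  have [l lH] := coins_neqT nT; rewrite inE in lH.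
  exists (coin_at l); last exact: coin_coin_at.
  apply: legal_lock; rewrite ?hH ?orbT //; first by rewrite inE in lH.
  by apply: lock_connected_few; rewrite card_coinsU1 // coin_coin_at addn1.
have [U oddU] := odd_group_exists (inv_uniq inv) odd_h hH.
have [v /andP[vU nv]|all_core] := pickP (fun v => (v \in group [set u in h] U) && ~~ core v).
  move: (vU); rewrite !inE => /and3P[vh _ /eqP key].
  by exists v; [apply: legal_noncore|rewrite key].
(* Without a lock, the odd group consists of a single coin [l]. Taking [l] is legal if every
   remaining lock keeps another coin. *)
have /set0Pn[v vU] : group [set u in h] U != set0.
  by apply: contraTneq oddU => ->; rewrite cards0.
move: (vU); rewrite inE => /and3P[vH nhv /eqP key].
exists v; last by rewrite key.
have /coinP[l E] : coin v.
  by have := all_core v; rewrite vU coreE (negbTE nhv) /= => /negbFE.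
have UE : U = [set l].
  rewrite -key E support_coin_at; apply/setDidPl.
  by rewrite disjoints1 inE -E.
apply: legal_lock; rewrite ?hH ?orbT //; first by rewrite inE in vH.
apply: lock_connected => u uH' nu.
have uH : u \notin [set w in h] by apply: contra uH' => uH; rewrite in_setU1 uH orbT.
have nhu : ~~ hub u by apply: contra nu; apply: core_hub.
have lH : l \notin coins [set w in h] by rewrite inE -E.
have [w wH /andP[/andP[cw wu] _]] := lock_nbr cH lH uH nu.
have /coinP[i Ei] : coin w.
  move: cw; rewrite coreE => /orP[hw|//].
  by move/forallP/(_ w)/implyP/(_ hw): hH => wH'; rewrite wH' in wH.
have iu : i \in support u :\: coins [set w in h].
  rewrite in_setD inE -Ei wH; apply: (subsetP wu); by rewrite Ei support_coin_at set11.
(* The remaining support of [u] is nonempty, as it contains [i], and differs from [[set l]], whose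
   group has no lock; so it contains a coin other than [l]. *)
have /subsetPn[i' i'u i'l] : ~~ (support u :\: coins [set w in h] \subset [set l]).
  apply: contraFN (all_core u) => sub; rewrite nu andbT inE uH nhu UE.
  by rewrite eqEcard sub cards1 card_gt0; apply/set0Pn; exists i.
move: i'u; rewrite in_setD inE => /andP[i'H i'u].
exists (coin_at i'); last by rewrite lock_coin_adj // core_coin ?coin_coin_at.
rewrite in_setU1 negb_or i'H andbT E (inj_eq coin_at_inj).
by rewrite inE in i'l.
Qed.

Local Notation sigma := (prefer g lock_rel greedy first_hub).

Lemma play_lock_inv (h : seq V) : play_against g lock_rel sigma h -> lock_inv h.
Proof.
elim=> {h} [|h v _ inv even_h lv|h _ inv odd_h ls]; first exact: lock_inv_nil.
  by apply: lock_inv_rcons => //; rewrite (negbTE even_h).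
apply: lock_inv_rcons => // _ nT.
have [v lv gv] := greedy_exists inv odd_h nT.
by have /andP[] := prefer_good first_hub lv gv.
Qed.

(** If coins were left, there would still be a legal move: a hub, else a lock, else any coin of the
    remaining clique. *)
Lemma lock_game_over (h : seq V) :
  play_against g lock_rel sigma h -> game_over g lock_rel h ->
  (forall v, coin v -> v \in h) /\ (alice_count coin h <= 2 * (a + t) + 3)%N.
Proof.
move=> ph over; have inv := play_lock_inv ph.
split; last by have := inv_alice inv; clear; lia.
suff /eqP cT : coins [set u in h] == setT.
  move=> v /coinP[l ->]; have : l \in coins [set u in h] by rewrite cT inE.
  by rewrite !inE.
apply/negPn/negP => nT.
have stuck v : legal_move g lock_rel h v -> False by rewrite (negbTE (over v)).
have [hH|nH] := boolP (hubs_taken [set u in h]); last first.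
  by have [z /stuck] := legal_hub inv nH.
have [v /andP[vh nv]|all_core] := pickP (fun v => (v \notin h) && ~~ core v).
  exact: stuck (legal_noncore (inv_conn inv) hH nT vh nv).
have [l lH] := coins_neqT nT; rewrite !inE in lH.
apply: (stuck (coin_at l)); apply: legal_lock; rewrite ?hH ?orbT //.
apply: lock_connected => u; rewrite !inE negb_or => /andP[_ uh] nu.
by have := all_core u; rewrite uh nu.
Qed.

Lemma lock_k_connected (k : nat) : (k <= t)%N -> k_connected lock_rel k.
Proof.
move=> kt; split.
  apply: leq_trans (leq_trans t_lt_m _); first by rewrite ltnS.
  rewrite -[X in (X <= _)%N]card_ord -(card_imset predT coin_at_inj).
  exact: max_card.
move=> X Xk; apply: lock_connected_few.
by apply: leq_trans (card_coins X) _; apply: leq_trans kt; apply: ltnW.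
Qed.

Lemma card_coin : (m <= #|coin|)%N.
Proof.
rewrite -[X in (X <= _)%N]card_ord -(card_imset predT coin_at_inj).
by apply/subset_leq_card/subsetP => _ /imsetP[l _ ->]; apply: coin_coin_at.
Qed.

End LockGraph.

(** * Choice of the parameters and conclusion *)

Lemma bob_wins_R (R : realType) (g : game) (eps : R) (k : nat) :
  requires_R g -> 0 < eps ->
  exists (V : finType) (e : rel V) (w : V -> R),
    [/\ simple_graph e,
        k_connected e k,
        (forall v, 0 <= w v),
        0 < \sum_(v : V) w v &
        bob_can_obtain g e w ((1 - eps) * \sum_(v : V) w v)].
Proof.
(* [2 ^ j] exceeds [k] and is at least 8, hence more than twice the number of hubs, which is at most
   2. *)
move=> gR eps0; pose j := (k + 3)%N.
have kt : (k < 2 ^ j)%N by apply: leq_trans (ltn_expl k (isT : 1 < 2)%N) _; rewrite leq_exp2l // leq_addr.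
have t8 : (8 <= 2 ^ j)%N by rewrite -[8%N]/(2 ^ 3)%N leq_exp2l // leq_addl.
(* [c] is Alice's bound from [lock_game_over] with [a] replaced by 2; [m] is chosen to exceed both
   [c / eps] and [2 ^ j]. *)
pose c := (2 * (2 + 2 ^ j) + 3)%N.
pose m := (Num.bound (c%:R / eps) + 2 ^ j).+1.
(* One or two hubs, making the number of vertices even. *)
pose a := (~~ odd #|{: {A : {set 'I_m} | #|A| == 1 %[mod 2 ^ j]}}|).+1.
have a2 : (a <= 2)%N by rewrite /a; case: odd.
have a_gt0 : (0 < a)%N by [].
have a_small : (2 * a < 2 ^ j)%N by lia.
pose V : finType := ('I_a + {A : {set 'I_m} | #|A| == 1 %[mod 2 ^ j]})%type.
have even_V : ~~ odd #|{: V}|.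
  by rewrite card_sum card_ord oddD /a; case: (odd #|_|).
have t_lt_m : (2 ^ j < m)%N by rewrite ltnS leq_addl.
have cw := card_coin a m j.
exists V, (@lock_rel a m j), (fun v => (coin v)%:R).
split.
- by split; [apply: lock_sym | move=> u; rewrite /lock_rel /= eqxx].
- by apply: lock_k_connected => //; apply: ltnW.
- by move=> v; apply: ler0n.
- rewrite -natr_sum ltr0n; apply: leq_trans (_ : m <= _)%N => //.
  apply: leq_trans cw _.
  by rewrite -sum1_card big_mkcond leq_sum.
apply: (@bob_can_obtain_of_count _ _ _ _ _ _ c (prefer g (@lock_rel a m j) (@greedy a m j) (first_hub m j a_gt0))).
- exact: prefer_strategy.
- move=> h ph over.
  have [allc hc] := lock_game_over a_small gR t_lt_m even_V ph over.
  by split=> //; apply: leq_trans hc _; rewrite /c; lia.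
rewrite mulrC -ler_pdivrMr //; apply: ltW; apply: lt_le_trans (archi_boundP _) _.
  by rewrite divr_ge0 // ltW.
by rewrite ler_nat; apply: leq_trans cw; apply: leqW; apply: leq_addr.
Qed.

Theorem theorem1 (R : realType) (g : game) (eps : R) (heps : 0 < eps)
    (k : nat) (hk : (1 <= k)%N) :
  exists (V : finType) (e : rel V) (w : V -> R),
    [/\ simple_graph e,
        k_connected e k,
        (forall v, 0 <= w v),
        0 < \sum_(v : V) w v &
        bob_can_obtain g e w ((1 - eps) * \sum_(v : V) w v)].
Proof.
case: g; first exact: bob_wins_T.
  exact: bob_wins_R.
exact: bob_wins_R.
Qed.
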